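(* Let $B\in\mathbb{C}\setminus\{0\}$ and consider the rational difference equation $$z_{n+1}=\frac{z_{n}^{2}+Bz_{n}}{z_{n-1}+B},\quad n=0,1,\dots,$$ with initial conditions $z_{0},z_{-1}\in\mathbb{C}$. Then its forbidden set $\mathfrak{F}$ (a set of pairs $(z_0,z_{-1})$) equals $$S_{4}=\bigcup_{c\in\mathbb{C}\setminus\{1\}}\left\{\left(\frac{B-Bc^{n+1}}{c-1},\frac{B-Bc^{n+2}}{c-1}\right)\,\middle|\,n\in\mathbb{N}\right\}\cup\left(\{-B\}\times\mathbb{C}\right)\cup\left(\mathbb{C}\times\{-B\}\right)\cup\left\{(-nB-B,-nB-2B)\,\middle|\,n\in\mathbb{N}\right\}.$$ Moreover, given $(z_{0},z_{-1})\notin\mathfrak{F}$, there are two possibilities: (i) $z_{0}=0$, in which case $z_{n}=0$ for all $n\geq 0$; (ii) $z_{0}\neq 0$, in which case $z_{n+1}=\frac{z_{n}+B}{C}$ for all $n\geq 0$, where $C=\frac{z_{-1}+B}{z_{0}}$. This implies $$z_{n}=\frac{z_{0}}{C^{n}}+\sum_{k=1}^{n}\frac{B}{C^{k}},\quad n\geq 1.$$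
   Context: The forbidden set $\mathfrak{F}$ of a second order rational difference equation is the set of initial conditions, written as pairs $(z_{0},z_{-1})\in\mathbb{C}^{2}$ in this order, for which the iteration eventually requires a division by zero (so that $z_n$ is not well defined for some $n\ge 1$; $0/0$ counts as undefined). $\mathbb{N}=\{1,2,3,\dots\}$. *)

(* Defs.v *)
From HB Require Import structures.
From mathcomp Require Import all_boot all_order all_algebra.
From mathcomp Require Import all_classical all_reals.
From mathcomp Require Import complex.

Set Implicit Arguments.
Unset Strict Implicit.
Unset Printing Implicit Defensive.

Import Order.TTheory GRing.Theory Num.Theory.

Local Open Scope classical_set_scope.
Local Open Scope ring_scope.

(* The second order equation z_{n+1} = P(z_n, z_{n-1}) / Q(z_n, z_{n-1}).
   Field division is total (x / 0 = 0), so undefinedness is made explicit: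
   None means that a division by zero, 0/0 included, has been required. *)
Definition rde_next (F : fieldType) (P Q : F -> F -> F) (s : F * F)
    : option (F * F) :=
  if Q s.1 s.2 == 0 then None else Some (P s.1 s.2 / Q s.1 s.2, s.1).

(* Some (z_n, z_{n-1}) if defined, starting from s = (z_0, z_{-1}). *)
Definition rde_state (F : fieldType) (P Q : F -> F -> F) (s : F * F) (n : nat)
    : option (F * F) :=
  iter n (obind (rde_next P Q)) (Some s).

Definition rde_term (F : fieldType) (P Q : F -> F -> F) (s : F * F) (n : nat)
    : option F :=
  omap fst (rde_state P Q s n).

Definition forbidden_set (F : fieldType) (P Q : F -> F -> F) : set (F * F) :=
  [set s | exists2 n, (1 <= n)%N & rde_term P Q s n = None].

(* The last set is the limit c -> 1 of the first family:
   (B - B c^m) / (c - 1) = - B (1 + c + ... + c^(m-1)). *)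
Definition S4 (R : realType) (B : R[i]) : set (R[i] * R[i]) :=
  (\bigcup_(c in [set~ 1])
     [set ((B - B * c ^+ (n + 1)) / (c - 1), (B - B * c ^+ (n + 2)) / (c - 1))
        | n in [set n : nat | (1 <= n)%N]])
  `|` ([set - B] `*` [set: R[i]])
  `|` ([set: R[i]] `*` [set - B])
  `|` [set (- (n%:R * B) - B, - (n%:R * B) - 2 * B)
        | n in [set n : nat | (1 <= n)%N]].

(* Main.v *)
Require Import Defs.
From HB Require Import structures.
From mathcomp Require Import all_boot all_order all_algebra.
From mathcomp Require Import all_classical all_reals.
From mathcomp Require Import complex.
From mathcomp Require Import ring.

(** The equation has a conserved quantity.  Write c = (z_(n-1) + B) / z_n,
    that is z_(n-1) = c z_n - B.  Then
      z_(n+1) = z_n (z_n + B) / (z_(n-1) + B) = (z_n + B) / c,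
    so z_n = c z_(n+1) - B, with the same c.  In the coordinates (x, c), where
    the state is (x, c x - B), the equation is thus the affine map
    x |-> (x + B) / c with c constant, and division by zero is required
    exactly when x = 0 (for c <> 0): this is [rde_next_affine_state].  Hence an
    orbit breaks down iff the affine iteration started at z_0 meets 0.

    For c <> 0, since c^k times the k-th affine iterate of x is x + B (1 + ... + c^(k-1)),
    the iteration meets 0 at time k iff x = - B (1 + ... + c^(k-1))
    ([iter_affine_eq0]).  This gives the forbidden set as the line z_(-1) = - B
    together with all the states (x, c x - B) with x of that form
    ([forbidden_setE]).  The set S4 has the same description ([S4E]): the cases
    c <> 1 and c = 1 of the geometric sums with k >= 2 are its two discrete
    families, k = 1 is the line z_0 = - B as c varies, and k = 0 falls in the
    line z_(-1) = - B.

    The states without such coordinates are those with z_0 = 0 and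
    z_(-1) <> - B, from which the orbit is constantly 0. *)

Set Implicit Arguments.
Unset Strict Implicit.
Unset Printing Implicit Defensive.

Import Order.TTheory GRing.Theory Num.Theory.

Local Open Scope classical_set_scope.
Local Open Scope ring_scope.

Local Notation eq_num B := (fun x y => x ^+ 2 + B * x).
Local Notation eq_den B := (fun x y => y + B).

Definition affine_map (F : fieldType) (B c x : F) : F := (x + B) / c.

(** Solving c = (y + B) / x for y, rather than starting from that quotient, keeps
    the states with x = 0 at which an orbit breaks down. *)
Definition affine_state (F : fieldType) (B c x : F) : F * F := (x, c * x - B).

(** * Geometric sums *)

Definition geom_sum (F : fieldType) (c : F) (k : nat) : F :=
  \sum_(i < k) c ^+ i.

Lemma geom_sumSr (F : fieldType) (c : F) k :
  geom_sum c k.+1 = geom_sum c k + c ^+ k.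
Proof. by rewrite /geom_sum big_ord_recr. Qed.

Lemma geom_sumSl (F : fieldType) (c : F) k :
  geom_sum c k.+1 = 1 + c * geom_sum c k.
Proof.
rewrite /geom_sum big_ord_recl expr0 mulr_sumr; congr (_ + _).
by apply: eq_bigr => i _; rewrite -exprS.
Qed.

Lemma geom_sum_c1 (F : fieldType) k : geom_sum (1 : F) k = k%:R.
Proof.
by elim: k => [|k IH]; rewrite ?geom_sumSr ?IH ?expr1n -?natr1 // /geom_sum
  big_ord0.
Qed.

Lemma geom_sum_neq1 (F : fieldType) (B c : F) k : c != 1 ->
  - B * geom_sum c k = (B - B * c ^+ k) / (c - 1).
Proof.
rewrite -subr_eq0 => c1; apply/(canRL (mulfK c1)).
have -> : B - B * c ^+ k = - B * (c ^+ k - 1) by ring.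
by rewrite subrX1 /geom_sum; ring.
Qed.

(** * The affine iteration *)

(** Clearing the denominator c^k turns the iterate into a forward geometric sum,
    which is meaningful for c = 1 and is the form taken by S4. *)
Lemma iter_affine_expr (F : fieldType) (B c x : F) k : c != 0 ->
  iter k (affine_map B c) x * c ^+ k = x + B * geom_sum c k.
Proof.
move=> c0; elim: k => [|k IH].
  by rewrite /= expr0 mulr1 /geom_sum big_ord0 mulr0 addr0.
rewrite iterS exprS mulrA /affine_map divfK // mulrDl IH geom_sumSr.
by rewrite mulrDr addrA.
Qed.

Lemma iter_affine_eq0 (F : fieldType) (B c x : F) k : c != 0 ->
  (iter k (affine_map B c) x == 0) = (x == - B * geom_sum c k).
Proof.
move=> c0; have ck0 : c ^+ k != 0 by rewrite expf_neq0.
by rewrite -[LHS](inj_eq (mulIf ck0)) mul0r iter_affine_expr // addr_eq0 mulNr.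
Qed.

Lemma iter_affine_sum (F : fieldType) (B c x : F) n :
  iter n (affine_map B c) x = x / c ^+ n + \sum_(1 <= k < n.+1) B / c ^+ k.
Proof.
elim: n => [|n IH]; first by rewrite /= big_geq // expr0 divr1 addr0.
rewrite iterS IH /affine_map !mulrDl -addrA exprSr invfM mulrA.
congr (_ + _); rewrite [in RHS]big_nat_recl // expr1 addrC; congr (_ + _).
by rewrite mulr_suml; apply: eq_bigr => k _; rewrite exprSr invfM mulrA.
Qed.

(** * The orbits of the difference equation *)

(** The conserved quantity at work: in these coordinates c stays fixed, and the
    denominator is c x. *)
Lemma rde_next_affine_state (F : fieldType) (B c x : F) : c != 0 ->
  rde_next (eq_num B) (eq_den B) (affine_state B c x) =
  if x == 0 then None else Some (affine_state B c (affine_map B c x)).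
Proof.
move=> c0; rewrite /rde_next /affine_state /affine_map /= subrK mulf_eq0.
rewrite (negbTE c0) /=; case: eqP => // /eqP x0; congr (Some (_, _)).
  by field; rewrite c0.
by rewrite mulrC divfK // addrK.
Qed.

Lemma rde_state_affine_state (F : fieldType) (B c x : F) n : c != 0 ->
  rde_state (eq_num B) (eq_den B) (affine_state B c x) n =
  if has (fun k => iter k (affine_map B c) x == 0) (iota 0 n) then None
  else Some (affine_state B c (iter n (affine_map B c) x)).
Proof.
move=> c0; elim: n => // n IH.
have -> : iota 0 n.+1 = rcons (iota 0 n) n by rewrite -cats1 -addn1 iotaD.
rewrite /rde_state iterS -/(rde_state _ _ _ n) IH has_rcons orbC.
by case: has => //; rewrite /obind /oapp rde_next_affine_state.
Qed.

(** The step n = 0 is never undefined, so the bound on n can be dropped. *)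
Lemma forbiddenP (F : fieldType) (P Q : F -> F -> F) s :
  forbidden_set P Q s <-> exists n, rde_state P Q s n = None.
Proof.
split=> [[n _]|[[|n] // sn]].
  by rewrite /rde_term; case E: rde_state => // _; exists n.
by exists n.+1; rewrite // /rde_term sn.
Qed.

Lemma forbidden_affine_state (F : fieldType) (B c x : F) : c != 0 ->
  forbidden_set (eq_num B) (eq_den B) (affine_state B c x) <->
  exists k, x = - B * geom_sum c k.
Proof.
move=> c0; rewrite forbiddenP; split=> [[n]|[k xk]].
  rewrite rde_state_affine_state //; case: hasP => // -[k _].
  by rewrite iter_affine_eq0 // => /eqP xk _; exists k.
exists k.+1; rewrite rde_state_affine_state // ifT //.
apply/hasP; exists k; first by rewrite mem_iota add0n ltnSn.
by rewrite iter_affine_eq0 // xk.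
Qed.

Lemma forbidden_den0 (F : fieldType) (B x : F) :
  forbidden_set (eq_num B) (eq_den B) (x, - B).
Proof. by apply/forbiddenP; exists 1%N; rewrite /= /rde_next /= addNr eqxx. Qed.

Lemma rde_term_zero (F : fieldType) (B y : F) n : B != 0 -> y != - B ->
  rde_term (eq_num B) (eq_den B) (0, y) n = Some 0.
Proof.
move=> B0 yB; rewrite /rde_term.
suff -> : rde_state (eq_num B) (eq_den B) (0, y) n =
          Some (0, if n is 0 then y else 0) by [].
elim: n => // n IH; rewrite /rde_state iterS -/(rde_state _ _ _ n) IH /=.
rewrite /rde_next /= expr0n mulr0 addr0 mul0r.
by case: n {IH} => [|n]; rewrite ?add0r ?addr_eq0 ?(negbTE yB) ?(negbTE B0).
Qed.

Lemma affine_stateE (F : fieldType) (B x y : F) : x != 0 ->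
  (x, y) = affine_state B ((y + B) / x) x.
Proof. by move=> x0; rewrite /affine_state divfK // addrK. Qed.

Lemma affine_ratio_neq0 (F : fieldType) (B x y : F) : x != 0 -> y != - B ->
  (y + B) / x != 0.
Proof. by move=> x0 yB; rewrite mulf_neq0 ?invr_neq0 // addr_eq0. Qed.

(** * The forbidden set *)

(** A forbidden state off the line y = - B has x <> 0, because the orbit of
    (0, y) is then constantly 0; so it has coordinates (x, c) with c <> 0.
    Conversely c = 0 gives only points of that line, so c needs no condition. *)
Lemma forbidden_setE (F : fieldType) (B x y : F) : B != 0 ->
  forbidden_set (eq_num B) (eq_den B) (x, y) <->
  y = - B \/ exists c k, (x, y) = affine_state B c (- B * geom_sum c k).
Proof.
move=> B0; have [->|yB] := eqVneq y (- B).
  by split=> _; [left | exact: forbidden_den0].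
split=> [fxy|[/eqP|[c [k xy]]]]; last 2 first.
- by rewrite (negbTE yB).
- have c0 : c != 0.
    apply: contraNneq yB => c0; case: xy => _ ->.
    by rewrite c0 mul0r add0r.
  by rewrite xy forbidden_affine_state //; exists k.
right; have [x0|x0] := eqVneq x 0.
  move: fxy => [n _]; rewrite x0 rde_term_zero //.
exists ((y + B) / x); move: fxy; rewrite (affine_stateE B y x0).
rewrite forbidden_affine_state ?affine_ratio_neq0 // => -[k xk].
by exists k; rewrite -xk.
Qed.

Lemma affine_state_geom_sum (F : fieldType) (B c : F) k :
  affine_state B c (- B * geom_sum c k) =
  (- B * geom_sum c k, - B * geom_sum c k.+1).
Proof. by rewrite /affine_state geom_sumSl; congr (_, _); ring. Qed.

Lemma S4E (R : realType) (B x y : R[i]) : B != 0 ->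
  S4 B (x, y) <->
  y = - B \/ exists c k, (x, y) = affine_state B c (- B * geom_sum c k).
Proof.
move=> B0.
have G1 (c : R[i]) : - B * geom_sum c 1 = - B.
  by rewrite /geom_sum big_ord1 expr0 mulr1.
split.
- case=> [[[[c c1 [n _ xy]]|[/= xB _]]|[_ /= yB]]|[n _ xy]].
  + right; exists c, (n + 1)%N; rewrite affine_state_geom_sum -xy.
    by rewrite !geom_sum_neq1 ?addn1 ?addn2 //; exact/eqP.
  + (* on the line x = - B every y is reached, by solving for c *)
    right; exists (- (y + B) / B), 1%N; rewrite G1 xB /affine_state.
    by congr (_, _); field; rewrite B0.
  + by left.
  + right; exists 1, n.+1; rewrite affine_state_geom_sum -xy !geom_sum_c1.
    by congr (_, _); ring.
- case=> [yB|[c [[|[|k]]]]].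
  + by left; right.
  + rewrite affine_state_geom_sum G1 => -[_ ->].
    by left; right.
  + rewrite affine_state_geom_sum G1 => -[-> _].
    by left; left; right.
  + rewrite affine_state_geom_sum => ->.
    have [->|c1] := eqVneq c 1.
      right; exists k.+1 => //; rewrite !geom_sum_c1; congr (_, _); ring.
    left; left; left; exists c; first exact/eqP.
    by exists k.+1; rewrite // !geom_sum_neq1 // addn1 addn2.
Qed.

Theorem theorem5 (R : realType) (B : R[i]) (hB : B != 0) :
  let P := fun x y : R[i] => x ^+ 2 + B * x in
  let Q := fun x y : R[i] => y + B in
  forbidden_set P Q = S4 B /\
  forall z0 zm1 : R[i], ~ forbidden_set P Q (z0, zm1) ->
    exists z : nat -> R[i],
      [/\ forall n : nat, rde_term P Q (z0, zm1) n = Some (z n),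
          z0 = 0 -> forall n : nat, z n = 0
        & z0 != 0 ->
          let C := (zm1 + B) / z0 in
          [/\ C != 0,
              forall n : nat, z n.+1 = (z n + B) / C
            & forall n : nat, (1 <= n)%N ->
                z n = z0 / C ^+ n + \sum_(1 <= k < n.+1) B / C ^+ k]].
Proof.
move=> P Q; split.
  by apply/seteqP; split=> -[x y]; rewrite forbidden_setE // S4E.
move=> z0 zm1 nf; have yB : zm1 != - B.
  by apply/eqP => yB; apply: nf; rewrite yB; exact: forbidden_den0.
have [z00|z00] := eqVneq z0 0.
  exists (fun=> 0); split=> // n.
  by rewrite z00 rde_term_zero.
set c := (zm1 + B) / z0.
have c0 : c != 0 by rewrite affine_ratio_neq0.
exists (fun n => iter n (affine_map B c) z0); split.
- move=> n; case E: (rde_state P Q (z0, zm1) n) => [s|]; last first.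
    by case: nf; apply/forbiddenP; exists n.
  rewrite /rde_term E; move: E; rewrite (affine_stateE B zm1 z00).
  by rewrite rde_state_affine_state //; case: has => // -[<-].
- by move=> z00'; rewrite z00' eqxx in z00.
- by move=> _; split=> // n _; exact: iter_affine_sum.
Qed.
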